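(* Let $K$ be a perfect field of characteristic $2$. For any $\beta,\delta\in K$, the Lie algebra $\mathscr L(\beta,\delta)$ over $K$ is isomorphic to the Lie algebra $\mathscr L(0,0)$.
   Context: For $\beta,\delta\in K$, $\mathscr L(\beta,\delta)$ denotes the $15$-dimensional Lie algebra over $K$ with basis $\{b_1,\dots,b_9,c_1,\dots,c_5,d\}$ and the following multiplication table (the bracket is alternating, so $[x,x]=0$ and $[x,y]=[y,x]$ in characteristic $2$; every bracket of two distinct basis elements not listed, up to order, is zero): $[b_1,b_2]=b_3$, $[b_1,b_3]=b_1$, $[b_1,b_4]=\beta c_5$, $[b_1,b_5]=b_6$, $[b_1,b_6]=b_4$, $[b_1,b_7]=\delta c_4$, $[b_1,b_8]=b_9$, $[b_1,b_9]=b_7$, $[b_1,c_1]=\delta c_5+d$, $[b_1,c_2]=c_3$, $[b_1,c_3]=c_1$, $[b_1,c_4]=b_2$, $[b_1,c_5]=b_5$, $[b_1,d]=\beta c_2$; $[b_2,b_3]=b_2$, $[b_2,b_4]=b_6$, $[b_2,b_6]=b_5$, $[b_2,b_7]=b_9$, $[b_2,b_9]=b_8$, $[b_2,c_1]=c_3$, $[b_2,c_3]=c_2$; $[b_3,b_4]=b_4$, $[b_3,b_5]=b_5$, $[b_3,b_7]=b_7$, $[b_3,b_8]=b_8$, $[b_3,c_1]=c_1$, $[b_3,c_2]=c_2$; $[b_4,b_7]=\delta c_5+d$, $[b_4,b_8]=c_3$, $[b_4,b_9]=c_1$, $[b_4,c_1]=b_3$, $[b_4,c_2]=c_4$, $[b_4,c_3]=b_2$,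 $[b_4,c_4]=b_5$, $[b_4,d]=b_1$; $[b_5,b_7]=c_3$, $[b_5,b_9]=c_2$, $[b_5,c_1]=c_4$, $[b_5,d]=b_2$; $[b_6,b_7]=c_1$, $[b_6,b_8]=c_2$, $[b_6,c_3]=c_4$, $[b_6,d]=b_3$; $[b_7,c_1]=b_6$, $[b_7,c_2]=c_5$, $[b_7,c_3]=b_5$, $[b_7,c_4]=b_8$, $[b_7,c_5]=c_2$, $[b_7,d]=b_4$; $[b_8,c_1]=c_5$, $[b_8,d]=b_5$; $[b_9,c_3]=c_5$, $[b_9,d]=b_6$; $[c_1,c_3]=b_8$, $[c_1,c_4]=c_2$, $[c_1,d]=b_7$; $[c_2,d]=b_8$; $[c_3,d]=b_9$; $[c_5,d]=c_4$. *)

(* Defs.v *)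
From HB Require Import structures.
From mathcomp Require Import all_boot all_order all_algebra all_field.

Set Implicit Arguments.
Unset Strict Implicit.
Unset Printing Implicit Defensive.

Import GRing.Theory.
Local Open Scope ring_scope.

Definition perfect_field (K : fieldType) : Prop :=
  forall p : {poly K}, irreducible_poly p -> separable_poly p.

HB.mixin Record isLieAlgebra (K : fieldType) L of GRing.Lmodule K L := {
  lie : L -> L -> L;
  lie_linear_l : forall y : L, linear (fun x : L => lie x y);
  lie_linear_r : forall x : L, linear (fun y : L => lie x y);
  lie_alternating : forall x : L, lie x x = 0;
  lie_jacobi : forall x y z : L,
    lie x (lie y z) + lie y (lie z x) + lie z (lie x y) = 0
}.

#[short(type="lieAlgType")]
HB.structure Definition LieAlgebra (K : fieldType) :=
  {L of GRing.Lmodule K L & isLieAlgebra K L}.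

Definition lie_isomorphic (K : fieldType) (L M : lieAlgType K) : Prop :=
  exists f : {linear L -> M},
    bijective f /\ forall x y : L, f (lie x y) = lie (f x) (f y).

Inductive gen :=
  | b1 | b2 | b3 | b4 | b5 | b6 | b7 | b8 | b9
  | c1 | c2 | c3 | c4 | c5
  | d.

Definition gens : seq gen :=
  [:: b1; b2; b3; b4; b5; b6; b7; b8; b9; c1; c2; c3; c4; c5; d].

Definition gen_code (g : gen) : nat :=
  match g with
  | b1 => 0 | b2 => 1 | b3 => 2 | b4 => 3 | b5 => 4 | b6 => 5
  | b7 => 6 | b8 => 7 | b9 => 8
  | c1 => 9 | c2 => 10 | c3 => 11 | c4 => 12 | c5 => 13
  | d => 14
  end.

Lemma gen_codeK : cancel gen_code (nth b1 gens).
Proof. by case. Qed.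

HB.instance Definition _ := Countable.copy gen (can_type gen_codeK).

Lemma gens_enum : Finite.axiom gens.
Proof. by case. Qed.

HB.instance Definition _ := isFinite.Build gen gens_enum.

Section Table.
Variables (K : fieldType) (beta delta : K).

Definition basis_vec (g : gen) : {ffun gen -> K^o} := [ffun h => (h == g)%:R].
Local Notation e := basis_vec.

(* Only the pairs listed in the multiplication table, each in one order;
   [bracket_gen] supplies the other order and the zero diagonal. *)
Definition half_table (x y : gen) : {ffun gen -> K^o} :=
  match x, y with
  | b1, b2 => e b3
  | b1, b3 => e b1
  | b1, b4 => beta *: e c5
  | b1, b5 => e b6
  | b1, b6 => e b4
  | b1, b7 => delta *: e c4
  | b1, b8 => e b9
  | b1, b9 => e b7
  | b1, c1 => delta *: e c5 + e d
  | b1, c2 => e c3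
  | b1, c3 => e c1
  | b1, c4 => e b2
  | b1, c5 => e b5
  | b1, d  => beta *: e c2

  | b2, b3 => e b2
  | b2, b4 => e b6
  | b2, b6 => e b5
  | b2, b7 => e b9
  | b2, b9 => e b8
  | b2, c1 => e c3
  | b2, c3 => e c2

  | b3, b4 => e b4
  | b3, b5 => e b5
  | b3, b7 => e b7
  | b3, b8 => e b8
  | b3, c1 => e c1
  | b3, c2 => e c2

  | b4, b7 => delta *: e c5 + e d
  | b4, b8 => e c3
  | b4, b9 => e c1
  | b4, c1 => e b3
  | b4, c2 => e c4
  | b4, c3 => e b2
  | b4, c4 => e b5
  | b4, d  => e b1

  | b5, b7 => e c3
  | b5, b9 => e c2
  | b5, c1 => e c4
  | b5, d  => e b2

  | b6, b7 => e c1
  | b6, b8 => e c2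
  | b6, c3 => e c4
  | b6, d  => e b3

  | b7, c1 => e b6
  | b7, c2 => e c5
  | b7, c3 => e b5
  | b7, c4 => e b8
  | b7, c5 => e c2
  | b7, d  => e b4

  | b8, c1 => e c5
  | b8, d  => e b5

  | b9, c3 => e c5
  | b9, d  => e b6

  | c1, c3 => e b8
  | c1, c4 => e c2
  | c1, d  => e b7

  | c2, d  => e b8
  | c3, d  => e b9
  | c5, d  => e c4

  | _, _ => 0
  end.

Definition bracket_gen (x y : gen) : {ffun gen -> K^o} :=
  half_table x y - half_table y x.

Definition bracket (u v : {ffun gen -> K^o}) : {ffun gen -> K^o} :=
  \sum_(x : gen) \sum_(y : gen) (u x * v y) *: bracket_gen x y.

Lemma bracket_linear_l v : linear (fun u => bracket u v).
Proof.
move=> a u w; rewrite /bracket scaler_sumr -big_split; apply: eq_bigr => x _ /=.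
rewrite scaler_sumr -big_split; apply: eq_bigr => y _ /=.
by rewrite !ffunE /= mulrDl scalerDl scalerA mulrA.
Qed.

Lemma bracket_linear_r u : linear (fun v => bracket u v).
Proof.
move=> a v w; rewrite /bracket scaler_sumr -big_split; apply: eq_bigr => x _ /=.
rewrite scaler_sumr -big_split; apply: eq_bigr => y _ /=.
by rewrite !ffunE /= mulrDr scalerDl scalerA mulrCA.
Qed.

Lemma bracket_alternating u : bracket u u = 0.
Proof.
rewrite /bracket /bracket_gen.
under eq_bigr => x _ do under eq_bigr => y _ do rewrite scalerBr.
under eq_bigr => x _ do rewrite sumrB.
rewrite sumrB [X in _ - X]exchange_big /= -sumrB big1 // => x _.
by rewrite -sumrB big1 // => y _; rewrite [u y * u x]mulrC subrr.
Qed.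

Lemma bracket_suml I (r : seq I) (a : I -> K) F v :
  bracket (\sum_(i <- r) a i *: F i) v = \sum_(i <- r) a i *: bracket (F i) v.
Proof.
elim: r => [|i r IH]; last by rewrite !big_cons bracket_linear_l IH.
rewrite !big_nil /bracket big1 // => x _; rewrite big1 // => y _.
by rewrite ffunE mul0r scale0r.
Qed.

Lemma bracket_sumr I (r : seq I) (a : I -> K) F u :
  bracket u (\sum_(i <- r) a i *: F i) = \sum_(i <- r) a i *: bracket u (F i).
Proof.
elim: r => [|i r IH]; last by rewrite !big_cons bracket_linear_r IH.
rewrite !big_nil /bracket big1 // => x _; rewrite big1 // => y _.
by rewrite ffunE mulr0 scale0r.
Qed.

Lemma basis_vec_sum (u : {ffun gen -> K^o}) : u = \sum_(x : gen) u x *: e x.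
Proof.
apply/ffunP=> y; rewrite sum_ffunE (bigD1 y) //= !ffunE eqxx [_ *: _]mulr1.
by rewrite big1 ?addr0 // => x /negPf nx; rewrite !ffunE eq_sym nx scaler0.
Qed.

Lemma bracket_basis x y : bracket (e x) (e y) = bracket_gen x y.
Proof.
rewrite /bracket (bigD1 x) //= (bigD1 y) //= !ffunE !eqxx mulr1 scale1r.
rewrite big1 ?addr0 => [|z /negPf nz].
  rewrite big1 ?addr0 // => z /negPf nz; rewrite big1 // => t _.
  by rewrite !ffunE nz mul0r scale0r.
by rewrite !ffunE nz mulr0 scale0r.
Qed.

Lemma bracket3 u v w : bracket u (bracket v w) =
  \sum_x \sum_y \sum_z (u x * v y * w z) *: bracket (e x) (bracket_gen y z).
Proof.
rewrite {1}(basis_vec_sum u) bracket_suml; apply: eq_bigr => x _.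
rewrite {1}(basis_vec_sum v) bracket_suml bracket_sumr scaler_sumr.
apply: eq_bigr => y _.
rewrite {1}(basis_vec_sum w) bracket_sumr bracket_sumr !scaler_sumr.
by apply: eq_bigr => z _; rewrite bracket_basis !scalerA.
Qed.

Hypothesis charK : 2%N \in [pchar K].

(* The Jacobi identity on basis vectors is decided symbolically: the triple
   (i, j, g) stands for beta ^+ i * delta ^+ j times the basis vector g, and a
   formal sum vanishes when each of its terms occurs an even number of times. *)
Let mono := (nat * nat * gen)%type.

Let eval (s : seq mono) : {ffun gen -> K^o} :=
  \sum_(t <- s) (beta ^+ t.1.1 * delta ^+ t.1.2) *: e t.2.

Let sym_half (x y : gen) : seq mono :=
  match x, y with
  | b1, b2 => [:: (0, 0, b3)]
  | b1, b3 => [:: (0, 0, b1)]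
  | b1, b4 => [:: (1, 0, c5)]
  | b1, b5 => [:: (0, 0, b6)]
  | b1, b6 => [:: (0, 0, b4)]
  | b1, b7 => [:: (0, 1, c4)]
  | b1, b8 => [:: (0, 0, b9)]
  | b1, b9 => [:: (0, 0, b7)]
  | b1, c1 => [:: (0, 1, c5); (0, 0, d)]
  | b1, c2 => [:: (0, 0, c3)]
  | b1, c3 => [:: (0, 0, c1)]
  | b1, c4 => [:: (0, 0, b2)]
  | b1, c5 => [:: (0, 0, b5)]
  | b1, d  => [:: (1, 0, c2)]
  | b2, b3 => [:: (0, 0, b2)]
  | b2, b4 => [:: (0, 0, b6)]
  | b2, b6 => [:: (0, 0, b5)]
  | b2, b7 => [:: (0, 0, b9)]
  | b2, b9 => [:: (0, 0, b8)]
  | b2, c1 => [:: (0, 0, c3)]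
  | b2, c3 => [:: (0, 0, c2)]
  | b3, b4 => [:: (0, 0, b4)]
  | b3, b5 => [:: (0, 0, b5)]
  | b3, b7 => [:: (0, 0, b7)]
  | b3, b8 => [:: (0, 0, b8)]
  | b3, c1 => [:: (0, 0, c1)]
  | b3, c2 => [:: (0, 0, c2)]
  | b4, b7 => [:: (0, 1, c5); (0, 0, d)]
  | b4, b8 => [:: (0, 0, c3)]
  | b4, b9 => [:: (0, 0, c1)]
  | b4, c1 => [:: (0, 0, b3)]
  | b4, c2 => [:: (0, 0, c4)]
  | b4, c3 => [:: (0, 0, b2)]
  | b4, c4 => [:: (0, 0, b5)]
  | b4, d  => [:: (0, 0, b1)]
  | b5, b7 => [:: (0, 0, c3)]
  | b5, b9 => [:: (0, 0, c2)]
  | b5, c1 => [:: (0, 0, c4)]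
  | b5, d  => [:: (0, 0, b2)]
  | b6, b7 => [:: (0, 0, c1)]
  | b6, b8 => [:: (0, 0, c2)]
  | b6, c3 => [:: (0, 0, c4)]
  | b6, d  => [:: (0, 0, b3)]
  | b7, c1 => [:: (0, 0, b6)]
  | b7, c2 => [:: (0, 0, c5)]
  | b7, c3 => [:: (0, 0, b5)]
  | b7, c4 => [:: (0, 0, b8)]
  | b7, c5 => [:: (0, 0, c2)]
  | b7, d  => [:: (0, 0, b4)]
  | b8, c1 => [:: (0, 0, c5)]
  | b8, d  => [:: (0, 0, b5)]
  | b9, c3 => [:: (0, 0, c5)]
  | b9, d  => [:: (0, 0, b6)]
  | c1, c3 => [:: (0, 0, b8)]
  | c1, c4 => [:: (0, 0, c2)]
  | c1, d  => [:: (0, 0, b7)]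
  | c2, d  => [:: (0, 0, b8)]
  | c3, d  => [:: (0, 0, b9)]
  | c5, d  => [:: (0, 0, c4)]
  | _, _ => [::]
  end%N.

Let sym_gen x y := sym_half x y ++ sym_half y x.

Let sym_bracket x (s : seq mono) : seq mono :=
  flatten [seq [seq ((t.1.1 + r.1.1)%N, (t.1.2 + r.1.2)%N, r.2)
               | r <- sym_gen x t.2] | t <- s].

Lemma eval_half x y : half_table x y = eval (sym_half x y).
Proof.
by case: x; case: y;
   rewrite /= /eval ?big_cons ?big_nil /= ?addr0 ?mulr1 ?mul1r ?scale1r.
Qed.

Lemma addvv (v : {ffun gen -> K^o}) : v + v = 0.
Proof. by apply/ffunP=> x; rewrite !ffunE addrr_pchar2. Qed.

Lemma eval_gen x y : bracket_gen x y = eval (sym_gen x y).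
Proof.
rewrite /bracket_gen !eval_half /eval big_cat /=; congr (_ + _).
by apply/eqP; rewrite eq_sym -addr_eq0 addvv.
Qed.

Lemma eval_bracket x s : bracket (e x) (eval s) = eval (sym_bracket x s).
Proof.
rewrite {1}/eval bracket_sumr /eval big_flatten big_map.
apply: eq_bigr => t _; rewrite bracket_basis eval_gen /eval scaler_sumr big_map.
by apply: eq_bigr => r _; rewrite scalerA /= !exprD mulrACA.
Qed.

Lemma eval_even s :
  all (fun t => ~~ odd (count_mem t s)) s -> eval s = 0.
Proof.
move=> /allP even_s; rewrite /eval -big_undup_iterop_count big_seq big1 // => t.
rewrite mem_undup => /even_s /even_halfK <-; rewrite Monoid.iteropE.
set v := _ *: _; elim: (_./2) => //= n IH.
by rewrite addrA addvv add0r.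
Qed.

Lemma sym_jacobi x y z :
  all (fun t => ~~ odd (count_mem t
        (sym_bracket x (sym_gen y z) ++ sym_bracket y (sym_gen z x)
           ++ sym_bracket z (sym_gen x y))))
      (sym_bracket x (sym_gen y z) ++ sym_bracket y (sym_gen z x)
         ++ sym_bracket z (sym_gen x y)).
Proof. by case: x; case: y; case: z; vm_compute. Qed.

Lemma bracket_jacobi u v w :
  bracket u (bracket v w) + bracket v (bracket w u) + bracket w (bracket u v)
  = 0.
Proof.
have rot2 : bracket v (bracket w u) =
    \sum_x \sum_y \sum_z
      (u x * v y * w z) *: bracket (e y) (bracket_gen z x).
  rewrite bracket3; under eq_bigr => y _ do rewrite exchange_big /=.
  rewrite exchange_big; do 3!apply: eq_bigr => ? _.
  by congr (_ *: _); rewrite mulrC mulrA.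
have rot3 : bracket w (bracket u v) =
    \sum_x \sum_y \sum_z
      (u x * v y * w z) *: bracket (e z) (bracket_gen x y).
  rewrite bracket3 exchange_big.
  under eq_bigr => x _ do rewrite exchange_big /=.
  do 3!apply: eq_bigr => ? _.
  by congr (_ *: _); rewrite -mulrA mulrC.
rewrite bracket3 rot2 rot3 -!big_split big1 // => x _.
rewrite -!big_split big1 // => y _; rewrite -!big_split big1 // => z _ /=.
rewrite -!scalerDr !eval_gen !eval_bracket -addrA /eval -!big_cat -/(eval _).
by rewrite eval_even ?scaler0 // sym_jacobi.
Qed.

End Table.

(* The carrier does not depend on charK, but the Jacobi identity needs it. *)
Definition L15 (K : fieldType) (charK : 2%N \in [pchar K]) (beta delta : K) :
  Type := {ffun gen -> K^o}.

HB.instance Definition _ K charK beta delta :=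
  Vector.copy (@L15 K charK beta delta) {ffun gen -> K^o}.

HB.instance Definition _ K charK beta delta :=
  isLieAlgebra.Build K (@L15 K charK beta delta)
    (bracket_linear_l beta delta) (bracket_linear_r beta delta)
    (bracket_alternating beta delta) (bracket_jacobi beta delta charK).

(* Main.v *)
Require Import Defs.
From HB Require Import structures.
From mathcomp Require Import all_boot all_order all_algebra all_field.
From Stdlib Require Import Classical.
Import GRing.Theory.
Local Open Scope ring_scope.

(** Write D for ad z, where z lies in a Lie algebra L of characteristic 2 and
    D o D = 0.  The truncated exponential 1 + s D then fails to be an
    automorphism in a controlled way: it is an involution which transports the
    bracket of L to the deformed bracket [u, v] + s^2 [D u, D v]
    ([exp_adK], [lie_exp_ad]).  Deforming a Lie algebra along the cocycle
    (u, v) |-> [D u, D v] by a square therefore does not change its isomorphism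
    class.

    Both parameters of the family are deformations of this kind.
    - The cocycle of ad b8, which squares to zero, takes the value c5 on (b1, b4)
      and c2 on (b1, d), and vanishes on the other pairs of basis vectors:
      these are the places where beta occurs in the multiplication table.
    - The cocycle of ad b5, which squares to zero as well, takes the values c4
      on (b1, b7), b5 on (b1, d) and c2 on (b7, d).  This matches the
      occurrences of delta once the table is rewritten in the basis where d is
      replaced by d + delta c5; then the entries delta c5 + d become basis
      vectors, and the brackets of the new vector with b1 and b7 acquire
      delta b5 and delta c2.
    Hence the isomorphism class of L(beta, delta) depends only on beta and delta
    modulo squares ([L15_beta_add_square], [L15_delta_add_square]).  In a
    perfect field of characteristic 2 everything is a square, so both
    parameters can be brought to 0.

    A grading suggests which z to try: giving the basis b1, ..., b9, c1, ..., c5,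
    d the weights 2, -2, 0, 1, -3, -1, 0, -4, -2, -1, -5, -3, -4, -5, 1 makes the
    table homogeneous when beta has weight 8 and delta has weight 6, so that
    ad z should have weight -4, respectively -3. *)

Set Implicit Arguments.
Unset Strict Implicit.
Unset Printing Implicit Defensive.

(** * Square roots in a perfect field of characteristic 2 *)

(** Without a root in K, the polynomial X^2 - a would be
    irreducible, hence separable; but its derivative 2 X is zero.  The
    argument is by contradiction and yields no procedure for finding the root,
    whence the appeal to classical logic. *)
Lemma perfect_field_sqrt (K : fieldType) (charK : 2%N \in [pchar K])
    (perfK : perfect_field K) (a : K) : exists s : K, a = s ^+ 2.
Proof.
apply: NNPP => no_sqrt; pose p : {poly K} := 'X^2 - a%:P.
have sp : size p = 3%N by rewrite size_XnsubC.
have dp : p^`() = 0.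
  by rewrite derivB derivXn derivC subr0 -mulr_natr -polyC_natr pcharf0 // mulr0.
have : separable_poly p.
  apply/perfK/cubic_irreducible => [|s]; first by rewrite sp.
  apply: contra_notN no_sqrt => /rootP.
  by rewrite !hornerE => /eqP; rewrite subr_eq0 => /eqP <-; exists s.
by rewrite unlock dp coprimep0 -size_poly_eq1 sp.
Qed.

(** * Truncated exponentials of square-zero inner derivations *)

Section SquareZero.
Variables (K : fieldType) (charK : 2%N \in [pchar K]).

Lemma addvv_char2 (V : lmodType K) (v : V) : v + v = 0.
Proof. by rewrite -[v]scale1r -scalerDl addrr_pchar2 ?scale0r. Qed.

Lemma oppv_char2 (V : lmodType K) (v : V) : - v = v.
Proof. by apply/eqP; rewrite eq_sym -addr_eq0 addvv_char2. Qed.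

Variable L : lieAlgType K.

HB.instance Definition _ (x : L) :=
  GRing.isLinear.Build K L L *:%R (lie x) (lie_linear_r x).

Lemma lieDl (x y z : L) : lie (x + y) z = lie x z + lie y z.
Proof. by have := lie_linear_l z 1 x y; rewrite !scale1r. Qed.

Lemma lie0l (x : L) : lie 0 x = 0.
Proof. by apply: (addIr (lie 0 x)); rewrite -lieDl !add0r. Qed.

Lemma lieZl a (x y : L) : lie (a *: x) y = a *: lie x y.
Proof. by have := lie_linear_l y a x 0; rewrite lie0l !addr0. Qed.

Lemma lieDr (x y z : L) : lie x (y + z) = lie x y + lie x z.
Proof. exact: linearD. Qed.

Lemma lieZr a (x y : L) : lie x (a *: y) = a *: lie x y.
Proof. exact: linearZ. Qed.

Lemma lieC (x y : L) : lie x y = lie y x.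
Proof.
have := lie_alternating (x + y).
rewrite lieDl !lieDr !lie_alternating add0r addr0 => /eqP.
by rewrite addr_eq0 oppv_char2 => /eqP.
Qed.

Lemma lie_derivation (z x y : L) :
  lie z (lie x y) = lie (lie z x) y + lie x (lie z y).
Proof.
apply/eqP; rewrite -subr_eq0 oppv_char2 [lie (lie z x) y]lieC [lie z y]lieC.
by rewrite addrA addrAC lie_jacobi.
Qed.

Definition exp_ad (s : K) (z u : L) : L := u + s *: lie z u.

Lemma exp_ad_linear s z : linear (exp_ad s z).
Proof.
move=> a u v.
by rewrite /exp_ad linearP !scalerDr !scalerA [s * a]mulrC addrACA.
Qed.

HB.instance Definition _ s z :=
  GRing.isLinear.Build K L L *:%R (exp_ad s z) (exp_ad_linear s z).

Variables (s : K) (z : L).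
Hypothesis sqz : forall u, lie z (lie z u) = 0.

Lemma exp_adK : involutive (exp_ad s z).
Proof.
move=> u; rewrite /exp_ad lieDr lieZr sqz scaler0 addr0 -addrA.
by rewrite addvv_char2 addr0.
Qed.

(** The terms of degree 0 and 1 in s agree because ad z is a derivation; the
    term of degree 2 on the left is the deformation on the right; the term of
    degree 3 on the right is ad z of [ad z u, ad z v], which the Leibniz rule
    expands into two brackets, each with a factor (ad z)^2. *)
Lemma lie_exp_ad u v : lie (exp_ad s z u) (exp_ad s z v) =
  exp_ad s z (lie u v + s ^+ 2 *: lie (lie z u) (lie z v)).
Proof.
have sqz_br : lie z (lie (lie z u) (lie z v)) = 0.
  by rewrite lie_derivation !sqz lie0l linear0 addr0.
rewrite /exp_ad lieDl !lieDr !lieZl !lieZr sqz_br scaler0 addr0.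
rewrite (lie_derivation z u v) scalerDr scalerA -expr2 -!addrA; congr (_ + _).
by rewrite [RHS]addrC -addrA addrCA.
Qed.

End SquareZero.

Lemma lie_isomorphic_trans (K : fieldType) (L M N : lieAlgType K) :
  lie_isomorphic L M -> lie_isomorphic M N -> lie_isomorphic L N.
Proof.
move=> [f [bij_f lie_f]] [g [bij_g lie_g]]; exists (g \o f).
by split=> [|u v]; [exact: bij_comp | rewrite /= lie_f lie_g].
Qed.

(** * Reduction to the multiplication table *)

Section Table.
Variables (K : fieldType) (charK : 2%N \in [pchar K]).
Local Notation V := {ffun gen -> K^o}.
Local Notation e := (basis_vec K).

HB.instance Definition _ (beta delta : K) (u : V) :=
  GRing.isLinear.Build K V V *:%R (bracket beta delta u)
    (bracket_linear_r beta delta u).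

Lemma bracketDl beta delta (u v w : V) :
  bracket beta delta (u + v) w = bracket beta delta u w + bracket beta delta v w.
Proof. exact: (@lieDl K (L15 charK beta delta)). Qed.

Lemma bracketDr beta delta (u v w : V) :
  bracket beta delta u (v + w) = bracket beta delta u v + bracket beta delta u w.
Proof. exact: linearD. Qed.

Lemma bracketZl beta delta a (u v : V) :
  bracket beta delta (a *: u) v = a *: bracket beta delta u v.
Proof. exact: (@lieZl K (L15 charK beta delta)). Qed.

Lemma bracketZr beta delta a (u v : V) :
  bracket beta delta u (a *: v) = a *: bracket beta delta u v.
Proof. exact: linearZ. Qed.

Lemma bracket0l beta delta (u : V) : bracket beta delta 0 u = 0.
Proof. exact: (@lie0l K (L15 charK beta delta)). Qed.

Lemma bracket0r beta delta (u : V) : bracket beta delta u 0 = 0.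
Proof. exact: linear0. Qed.

Lemma linear_expand (f : {linear V -> V}) u : f u = \sum_x u x *: f (e x).
Proof.
by rewrite {1}(basis_vec_sum u) linear_sum; under eq_bigr do rewrite linearZ.
Qed.

Lemma bracket_expand beta delta (f g : {linear V -> V}) u v :
  bracket beta delta (f u) (g v) =
  \sum_x \sum_y (u x * v y) *: bracket beta delta (f (e x)) (g (e y)).
Proof.
rewrite linear_expand bracket_suml; apply: eq_bigr => x _.
rewrite [g v]linear_expand bracket_sumr scaler_sumr.
by apply: eq_bigr => y _; rewrite scalerA.
Qed.

Lemma linear_bracket_expand beta delta (f : {linear V -> V}) u v :
  f (bracket beta delta u v) =
  \sum_x \sum_y (u x * v y) *: f (bracket_gen beta delta x y).
Proof.
rewrite linear_sum; apply: eq_bigr => x _; rewrite linear_sum.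
by apply: eq_bigr => y _; rewrite linearZ.
Qed.

(** The map g is the change of basis after which the table of
    L(beta', delta') becomes that of L(beta, delta) deformed by s ^+ 2 times the
    cocycle of ad z; all hypotheses concern basis vectors only. *)
Lemma L15_iso_of_deformation beta delta beta' delta' s (z : V)
    (g : {linear V -> V}) :
    bijective g ->
    (forall x, bracket beta delta z (bracket beta delta z (e x)) = 0) ->
    (forall x y, g (bracket_gen beta' delta' x y) =
       bracket beta delta (g (e x)) (g (e y))
       + s ^+ 2 *: bracket beta delta (bracket beta delta z (g (e x)))
                                      (bracket beta delta z (g (e y)))) ->
  lie_isomorphic (L15 charK beta' delta') (L15 charK beta delta).
Proof.
move=> bij_g sqz def_br.
pose L : lieAlgType K := L15 charK beta delta; pose zL : L := z.
pose D : {linear V -> V} := bracket beta delta z.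
have sqzL (u : L) : lie zL (lie zL u) = 0.
  rewrite -[LHS]/((D \o D) u) linear_expand big1 // => x _.
  by rewrite /= sqz scaler0.
have gbr u v : g (bracket beta' delta' u v) = bracket beta delta (g u) (g v)
       + s ^+ 2 *: bracket beta delta (D (g u)) (D (g v)).
  rewrite linear_bracket_expand bracket_expand.
  rewrite (bracket_expand beta delta (D \o g) (D \o g)).
  rewrite scaler_sumr -big_split; apply: eq_bigr => x _ /=.
  rewrite scaler_sumr -big_split; apply: eq_bigr => y _ /=.
  by rewrite def_br scalerDr !scalerA [_ * s ^+ 2]mulrC.
pose gL : {linear L15 charK beta' delta' -> L} := g.
exists (exp_ad s zL \o gL); split=> [|u v].
  by apply: bij_comp bij_g; apply: inv_bij; apply: exp_adK.
by rewrite /= lie_exp_ad //; congr (exp_ad s zL _); exact: gbr.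
Qed.

(** * The two parameters modulo squares *)

Lemma L15_beta_add_square beta delta s :
  lie_isomorphic (L15 charK (beta + s ^+ 2) delta) (L15 charK beta delta).
Proof.
have D x : bracket beta delta (e b8) (e x) =
    oapp e 0 match x with
    | b1 => Some b9 | b3 => Some b8 | b4 => Some c3 | b6 => Some c2
    | c1 => Some c5 | d => Some b5 | _ => None
    end.
  rewrite bracket_basis /bracket_gen.
  by case: x; rewrite /= ?subrr ?subr0 ?sub0r ?oppv_char2.
apply: (@L15_iso_of_deformation _ _ _ _ s (e b8) idfun) => [|x|x y].
- by exists idfun.
- by rewrite D; case: x; rewrite /= ?D ?bracket0r.
rewrite /= !D bracket_basis.
by case: x; case: y;
   rewrite /= ?bracket0l ?bracket0r ?bracket_basis /bracket_gen
     /= ?subrr ?subr0 ?sub0r ?oppv_char2 // ?scaler0 ?addr0 // scalerDl.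
Qed.

(** The change of basis d |-> d + a c5. *)
Definition add_c5 (a : K) (u : V) : V := u + (a * u d) *: e c5.

Lemma add_c5_linear a : linear (add_c5 a).
Proof.
move=> k u v; rewrite /add_c5 !ffunE -[k *: u d]/(k * u d).
by rewrite mulrDr mulrCA scalerDl scalerDr scalerA addrACA.
Qed.

HB.instance Definition _ a :=
  GRing.isLinear.Build K V V *:%R (add_c5 a) (add_c5_linear a).

Lemma add_c5D a u v : add_c5 a (u + v) = add_c5 a u + add_c5 a v.
Proof. exact: linearD. Qed.

Lemma add_c5Z a k u : add_c5 a (k *: u) = k *: add_c5 a u.
Proof. exact: linearZ. Qed.

Lemma add_c5K a : involutive (add_c5 a).
Proof.
move=> u; rewrite /add_c5 !ffunE /= scaler0 addr0 -addrA.
by rewrite addvv_char2 // addr0.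
Qed.

Lemma add_c5_basis a x :
  add_c5 a (e x) = if x is d then e d + a *: e c5 else e x.
Proof.
rewrite /add_c5 ffunE; case: x; rewrite /= ?mulr0 ?scale0r ?addr0 //.
by rewrite mulr1.
Qed.

Lemma L15_delta_add_square beta delta s :
  lie_isomorphic (L15 charK beta (delta + s ^+ 2)) (L15 charK beta delta).
Proof.
have D x : bracket beta delta (e b5) (e x) =
    oapp e 0 match x with
    | b1 => Some b6 | b3 => Some b5 | b7 => Some c3 | b9 => Some c2
    | c1 => Some c4 | d => Some b2 | _ => None
    end.
  rewrite bracket_basis /bracket_gen.
  by case: x; rewrite /= ?subrr ?subr0 ?sub0r ?oppv_char2.
(* The change of basis does not affect the cocycle, since [b5, c5] = 0. *)
have DG x : bracket beta delta (e b5) (add_c5 (s ^+ 2) (e x)) =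
            bracket beta delta (e b5) (e x).
  rewrite add_c5_basis; case: x => //.
  by rewrite bracketDr bracketZr [X in _ *: X]D scaler0 addr0.
apply: (@L15_iso_of_deformation _ _ _ _ s (e b5) (add_c5 (s ^+ 2))) => [|x|x y].
- exact: inv_bij (add_c5K _).
- by rewrite D; case: x; rewrite /= ?D ?bracket0r.
rewrite /= !DG !D !add_c5_basis.
case: x; case: y;
  rewrite /= ?bracket_alternating ?bracketDl ?bracketDr ?bracketZl ?bracketZr
    ?bracket0l ?bracket0r ?bracket_basis /bracket_gen
    /= ?subrr ?subr0 ?sub0r ?oppv_char2 //
    ?add_c5D ?add_c5Z ?add_c5_basis ?linear0 ?scaler0 ?addr0 ?add0r //
    -?addrA ?addvv_char2 ?addr0 // scalerDl //.
(* What remains are the entries delta c5 + d, where the change of basis cancels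
   the increment of delta. *)
all: by rewrite addrACA addvv_char2 // addr0.
Qed.

End Table.

Unset Implicit Arguments.

Theorem theorem1 (K : fieldType) (charK : 2%N \in [pchar K])
    (perfK : perfect_field K) (beta delta : K) :
  lie_isomorphic (L15 charK beta delta) (L15 charK 0 0).
Proof.
have [s ->] := perfect_field_sqrt charK perfK beta.
have [t ->] := perfect_field_sqrt charK perfK delta.
rewrite -[s ^+ 2]add0r -[t ^+ 2]add0r.
apply: lie_isomorphic_trans (L15_beta_add_square charK 0 _ s) _.
exact: L15_delta_add_square.
Qed.
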